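(* For every even positive integer $n$ there exists a bijection $\psi\colon\{0,1\}^n\to\mathcal{B}_n$, where $\mathcal{B}_n=\{x\in\{0,1\}^{n+1}: |x|>n/2\}$, such that for all $x\ne y$ in $\{0,1\}^n$, \[ \frac15\le\frac{\mathrm{distance}(\psi(x),\psi(y))}{\mathrm{distance}(x,y)}\le 4 . \]
   Context: For a binary string $x$, $|x|$ denotes its Hamming weight (number of ones), and $\mathrm{distance}(\cdot,\cdot)$ denotes the Hamming distance between binary strings of equal length. *)

(* Defs.v *)
From mathcomp Require Import all_boot all_order all_algebra.

Set Implicit Arguments.
Unset Strict Implicit.
Unset Printing Implicit Defensive.

Import Order.TTheory GRing.Theory Num.Theory.
Local Open Scope ring_scope.

Definition weight (n : nat) (x : n.-tuple bool) : nat :=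
  #|[set i : 'I_n | tnth x i]|.

Definition distance (n : nat) (x y : n.-tuple bool) : nat :=
  #|[set i : 'I_n | tnth x i != tnth y i]|.

Definition hamming_ball (n : nat) : {set n.+1.-tuple bool} :=
  [set x | n%:R / 2%:R < (weight x)%:R :> rat].

(* Main.v *)
(** Read a string left to right with a counter: a one increments it; a zero
decrements it if it is positive, and otherwise is an unmatched zero and is
replaced by a one.  Starting at [k], all but [k] of the unmatched zeros get
flipped.  If [x] has [b] unmatched zeros (starting at 0), then [psi x] starts the
counter at [floor (b / 2)] and records the parity of [b] in an extra bit; this is
the bijection obtained by folding each symmetric chain of the de
Bruijn-Tengbergen-Kruyswijk decomposition in two.  The transducer is
reversible: up to reversal and complementation, running it backwards from its
final counter is the same transducer, and for [psi x] this final counter is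
determined by the weight.  Two runs on the same input with different counters
drift together, each difference between the outputs reducing the gap by one;
hence both [psi] and its inverse are Lipschitz along edges.  Since the ball is an
up-set, two of its points are joined by a geodesic inside it through their
join, so edges suffice. *)

Require Import Defs.
From mathcomp Require Import all_boot all_order all_algebra.
From mathcomp Require Import zify.

Set Implicit Arguments.
Unset Strict Implicit.
Unset Printing Implicit Defensive.

Import Order.TTheory GRing.Theory Num.Theory.

Implicit Types (l s t p q : seq bool) (k m n : nat).

(** * Hamming distance and joins on lists *)

Definition hamming s t : nat := count (fun c => c.1 != c.2) (zip s t).

Lemma hamming_cons a b s t :
  hamming (a :: s) (b :: t) = (a != b) + hamming s t.
Proof. by []. Qed.

Lemma hamming_cat s s' t t' : size s = size t ->
  hamming (s ++ s') (t ++ t') = hamming s t + hamming s' t'.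
Proof. by move=> st; rewrite /hamming zip_cat // count_cat. Qed.

Lemma hammingxx s : hamming s s = 0.
Proof. by elim: s => //= a s IH; rewrite hamming_cons eqxx. Qed.

Lemma hammingC s t : hamming s t = hamming t s.
Proof.
by elim: s t => [|a s IH] [|b t] //; rewrite !hamming_cons IH eq_sym.
Qed.

Lemma hamming_triangle t s s' : size s = size t -> size t = size s' ->
  hamming s s' <= hamming s t + hamming t s'.
Proof.
elim: t s s' => [|b t IH] [|a s] [|c s'] //= [st] [ts].
have := IH _ _ st ts; rewrite !hamming_cons.
by case: a b c => [] [] []; rewrite /=; lia.
Qed.

Fixpoint join s t : seq bool :=
  match s, t with
  | a :: s, b :: t => (a || b) :: join s t
  | _, _ => [::]
  end.

Lemma size_join s t : size s = size t -> size (join s t) = size s.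
Proof. by elim: s t => [|a s IH] [|b t] //= [st]; rewrite IH. Qed.

Lemma joinC s t : join s t = join t s.
Proof. by elim: s t => [|a s IH] [|b t] //=; rewrite IH orbC. Qed.

(** Where two letters differ, exactly one of them differs from their disjunction. *)
Lemma hamming_join s t : size s = size t ->
  hamming s t = hamming s (join s t) + hamming t (join s t).
Proof.
elim: s t => [|a s IH] [|b t] //= [st]; rewrite !hamming_cons IH //.
by case: a b => [] []; rewrite /=; lia.
Qed.

(** * From edges to arbitrary pairs of an up-set *)

Section EdgeLipschitz.

Variables (n C : nat) (P : pred (seq bool)) (f : seq bool -> seq bool).
Hypothesis size_f : forall s t, size s = size t -> size (f s) = size (f t).
Hypothesis P_up : forall p q, P (p ++ false :: q) -> P (p ++ true :: q).
Hypothesis edge : forall p q, size (p ++ false :: q) = n ->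
  P (p ++ false :: q) -> hamming (f (p ++ false :: q)) (f (p ++ true :: q)) <= C.

Let lipschitz_joinr s t : size s = size t -> size s = n -> P s ->
  hamming (f s) (f (join s t)) <= C * hamming s (join s t).
Proof.
(* The zeros to be raised are treated from left to right, [p] being the part already done; [P_up]
   keeps every intermediate string in [P]. *)
suff H p : size s = size t -> size (p ++ s) = n -> P (p ++ s) ->
  hamming (f (p ++ s)) (f (p ++ join s t)) <= C * hamming s (join s t).
  exact: (H [::]).
elim: s t p => [|a s IH] [|b t] p //=; first by rewrite cats0 hammingxx.
case=> st; rewrite hamming_cons.
have IHp c : size (p ++ c :: s) = n -> P (p ++ c :: s) ->
    hamming (f (p ++ c :: s)) (f (p ++ c :: join s t))
    <= C * hamming s (join s t).
  by move=> sn Ps; have := IH t (rcons p c) st; rewrite !cat_rcons; apply.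
case: a b => [] [] sn Ps /=; rewrite ?eqxx ?add0n; try exact: IHp.
have st' : size (p ++ false :: s) = size (p ++ true :: s) by rewrite !size_cat.
have sj : size (p ++ true :: s) = size (p ++ true :: join s t).
  by rewrite !size_cat /= size_join.
rewrite mulnDr muln1.
apply: leq_trans (hamming_triangle (size_f st') (size_f sj)) _.
by rewrite leq_add ?edge // IHp -?st' // P_up.
Qed.

Lemma lipschitz_of_edges s t : size s = n -> size t = n -> P s -> P t ->
  hamming (f s) (f t) <= C * hamming s t.
Proof.
move=> sn tn Ps Pt; have st : size s = size t by rewrite sn.
have szj := size_join st.
rewrite (hamming_join st) mulnDr.
apply: leq_trans (hamming_triangle (size_f (esym szj)) (size_f _)) _.
  by rewrite szj.
rewrite leq_add ?lipschitz_joinr // hammingC joinC.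
by rewrite lipschitz_joinr.
Qed.

End EdgeLipschitz.

(** * The counter transducer *)

Fixpoint transduce k s : seq bool :=
  match s with
  | [::] => [::]
  | true :: s => true :: transduce k.+1 s
  | false :: s => (k == 0) :: transduce k.-1 s
  end.

Definition final k s : nat := foldl (fun k b => if b then k.+1 else k.-1) k s.

(** Read from the right, a one cancels an unmatched zero of the suffix; the truncated predecessor
    covers the case where there is none. *)
Definition unmatched s : nat :=
  foldr (fun b (r : nat) => if b then r.-1 else r.+1) 0 s.

Lemma size_transduce k s : size (transduce k s) = size s.
Proof. by elim: s k => //= [[]] s IH k /=; rewrite IH. Qed.

Lemma transduce_cat k s t :
  transduce k (s ++ t) = transduce k s ++ transduce (final k s) t.
Proof. by elim: s k => //= [[]] s IH k /=; rewrite IH. Qed.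

Lemma final_cat k s t : final k (s ++ t) = final (final k s) t.
Proof. exact: foldl_cat. Qed.

Lemma unmatched_cat s t :
  unmatched (s ++ t) = unmatched s + (unmatched t - final 0 s).
Proof.
(* A starting counter [k] absorbs the first [k] unmatched zeros. *)
suff H k : unmatched (s ++ t) - k
    = unmatched s - k + (unmatched t - final k s) by have := H 0; lia.
elim: s k => [|[] s IH] k /=; first by rewrite sub0n.
  by have := IH k.+1; lia.
by case: k => [|k] /=; [have := IH 0|have := IH k]; lia.
Qed.

Lemma count_transduce k s :
  count id (transduce k s) = count id s + (unmatched s - k).
Proof.
elim: s k => [|[] s IH] k //=; rewrite IH /=; first lia.
by case: k => [|k] /=; lia.
Qed.

(** Ones raise the counter and zeros lower it, except the [unmatched s - k] zeros met at counter
    0. *)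
Lemma finalE k s :
  final k s + size s = k + (count id s).*2 + (unmatched s - k).
Proof.
elim: s k => [|[] s IH] k /=; first lia.
  by have := IH k.+1; lia.
by case: k => [|k] /=; [have := IH 0|have := IH k]; lia.
Qed.

Lemma final0E k s : final k s = final 0 s + (k - unmatched s).
Proof. by have := finalE k s; have := finalE 0 s; lia. Qed.

(** Each position where the outputs differ is an unmatched zero for the smaller
counter only, and brings the counters one step closer. *)
Lemma hamming_transduce k m s : k <= m ->
  hamming (transduce k s) (transduce m s)
  = (unmatched s - k) - (unmatched s - m).
Proof.
elim: s k m => [|[] s IH] k m km //=; rewrite hamming_cons.
  by rewrite IH //; lia.
case: k m km => [|k] [|m] km //=.
- by rewrite IH //; lia.
- by rewrite IH //; lia.
- by rewrite IH //; lia.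
Qed.

Lemma hamming_transduce_le k m s :
  hamming (transduce k s) (transduce m s) <= (k - m) + (m - k).
Proof.
by case: (leqP k m) => km; [|rewrite hammingC];
   rewrite hamming_transduce; lia.
Qed.

(** * Reversibility of the transducer *)

Definition revneg s : seq bool := rev (map negb s).

Lemma revnegK : involutive revneg.
Proof.
by move=> s; rewrite /revneg map_rev revK -map_comp map_id_in // => - [].
Qed.

Lemma size_revneg s : size (revneg s) = size s.
Proof. by rewrite size_rev size_map. Qed.

Lemma revneg_cat s t : revneg (s ++ t) = revneg t ++ revneg s.
Proof. by rewrite /revneg map_cat rev_cat. Qed.

Lemma revneg_cons b s : revneg (b :: s) = rcons (revneg s) (~~ b).
Proof. by rewrite /revneg /= rev_cons. Qed.

Lemma hamming_revneg s t : size s = size t ->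
  hamming (revneg s) (revneg t) = hamming s t.
Proof.
elim: s t => [|a s IH] [|b t] //= [st].
rewrite !revneg_cons -!cats1 hamming_cat ?size_revneg // IH //.
by rewrite addnC !hamming_cons hammingxx addn0; case: a b => [] [].
Qed.

(** Complementing makes each letter undo its counter step. A flipped zero is told from a genuine one
    because its complement meets counter 0, not a positive one. *)
Lemma transduce_reverse k s :
  transduce (final k s) (revneg (transduce k s)) = revneg s
  /\ final (final k s) (revneg (transduce k s)) = k.
Proof.
elim: s k => [|[] s IH] k //=; rewrite !revneg_cons -!cats1.
  by have [E1 E2] := IH k.+1; rewrite transduce_cat final_cat E1 E2.
have [E1 E2] := IH k.-1.
by rewrite transduce_cat final_cat E1 E2; case: k {E1 E2 IH}.
Qed.

(** * The bijection and its inverse *)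

Definition encode s : seq bool :=
  ~~ odd (unmatched s) :: transduce (unmatched s)./2 s.

(** On an encoding, the starting counter is the final counter of the forward run; storing the
    negated parity lets one formula serve both parities. *)
Definition decode s : seq bool :=
  if s is b :: t then
    revneg (transduce ((count id t).*2 + b - (size t).+1) (revneg t))
  else [::].

Definition heavy s : bool := size s <= (count id s).*2.

Lemma size_encode s : size (encode s) = (size s).+1.
Proof. by rewrite /= size_transduce. Qed.

Lemma size_decode s : size (decode s) = (size s).-1.
Proof. by case: s => //= b s; rewrite size_revneg size_transduce size_revneg. Qed.

Lemma heavy_encode s : heavy (encode s).
Proof.
rewrite /heavy /= size_transduce count_transduce.
by have := finalE (unmatched s)./2 s; case: (boolP (odd _)) => /=; lia.
Qed.

Lemma encodeK : cancel encode decode.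
Proof.
move=> s; rewrite /= size_transduce count_transduce.
set k := (unmatched s)./2.
have [E _] := transduce_reverse k s.
rewrite (_ : _ - _ = final k s) ?E ?revnegK //.
have := finalE k s; rewrite /k.
by case: (boolP (odd _)) => /=; lia.
Qed.

Lemma decodeK s : ~~ odd (size s).-1 -> 0 < size s -> heavy s ->
  encode (decode s) = s.
Proof.
case: s => // b t; rewrite /heavy /= => ev _ hv.
set k0 := _ - _; set x := revneg _.
have [E F] := transduce_reverse k0 (revneg t).
set k := final k0 (revneg t) in E F.
rewrite -/x revnegK in E F; rewrite /encode.
have Ec := count_transduce k x; rewrite E in Ec.
have := finalE k x; rewrite F.
have -> : size x = size t by rewrite size_revneg size_transduce size_revneg.
move=> Ef.
(* Evenness and heaviness make the subtraction in [k0] exact, so comparing weights gives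
   [unmatched x - k = k + ~~ b]. *)
have [-> ->] : (unmatched x)./2 = k /\ odd (unmatched x) = ~~ b.
  by move: Ec Ef ev hv; rewrite /k0; case: (b) => /=; split; lia.
by rewrite E negbK.
Qed.

(** * Lipschitz constants along edges *)

Lemma encode_edge p q :
  hamming (encode (p ++ false :: q)) (encode (p ++ true :: q)) <= 4.
Proof.
rewrite /encode hamming_cons !transduce_cat hamming_cat ?size_transduce //.
rewrite !unmatched_cat /= hamming_cons.
set r := unmatched p; set u := unmatched q; set e := final 0 p.
set b := r + _; set c := r + _; rewrite (final0E b./2) (final0E c./2) -/r -/e.
have half_cb : c./2 <= b./2 <= (c./2).+1.
  have [cb bc] : c <= b /\ b <= c.+2 by rewrite /b /c; lia.
  by rewrite half_leq //=; exact: (half_leq bc).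
rewrite (hammingC (transduce b./2 p)) !hamming_transduce -/r -/u; [|lia..].
have gap_p : r - c./2 - (r - b./2) <= 1.
  by move: half_cb; clear; move: b./2 c./2 => k m; lia.
have le_final : e + (c./2 - r) <= e + (b./2 - r).
  by rewrite leq_add2l leq_sub2r //; case/andP: half_cb.
have le_e : e <= e + (b./2 - r) by exact: leq_addr.
move: (e + (b./2 - r)) (e + (c./2 - r)) le_final le_e => eb ec le_final le_e.
(* The bound 4 is 1 for the prefix, 1 for the raised letter and 2 for suffix and parity bit
   together: if [e < u] the parity is kept, otherwise the suffix changes at most once. *)
have gap_q : (~~ odd b != ~~ odd c) + (u - eb.-1 - (u - ec.+1)) <= 2.
  have [lt_eu|le_ue] := ltnP e u.
    have -> : b = c.+2 by rewrite /b /c; lia.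
    by rewrite /= negbK eqxx; move: le_final; clear; lia.
  by move: le_e le_ue; clear; case: (_ != _) => /=; lia.
move: gap_p gap_q; clear.
by move: (r - _ - _) (u - _ - _) (_ != _ :> bool) (_ == 0) => k m [] [] /=; lia.
Qed.

Lemma decode_edge n p q : ~~ odd n -> size (p ++ false :: q) = n.+1 ->
  heavy (p ++ false :: q) ->
  hamming (decode (p ++ false :: q)) (decode (p ++ true :: q)) <= 5.
Proof.
rewrite /heavy => ev sn; rewrite sn; case: p sn => [|b p] /=.
  move=> [sn] hv; rewrite hamming_revneg ?size_transduce //.
  by apply: leq_trans (hamming_transduce_le _ _ _) _; lia.
move=> [sn] hv; rewrite hamming_revneg ?size_transduce ?size_revneg ?size_cat //.
rewrite !revneg_cat !revneg_cons !cat_rcons /=.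
rewrite !count_cat /= addnS; set k := _ - _; set m := _ - _.
(* Neither subtraction is truncated, by heaviness and the evenness of [n]. *)
have {m hv} -> : m = k.+2.
  by move: hv sn; rewrite /m /k count_cat size_cat /=; case: (b) => /=; lia.
move: (revneg q) (revneg p) => s t.
rewrite !transduce_cat hamming_cat ?size_transduce //= hamming_cons.
(* If the outputs on [s] differ in [h <= 2] places, the counters end [2 - h] apart, and the
   differing letter leaves a gap of at most [h] for [t]: in total at most [2 * h + 1 <= 5]. *)
have := finalE k s; have := finalE k.+2 s.
rewrite hamming_transduce; last lia.
have := hamming_transduce_le (final k s).+1 (final k.+2 s).-1 t.
by case: (_ == 0); rewrite /=; lia.
Qed.

Lemma heavy_up p q : heavy (p ++ false :: q) -> heavy (p ++ true :: q).
Proof. by rewrite /heavy !size_cat !count_cat /=; lia. Qed.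

Lemma hamming_encode s t : size s = size t ->
  hamming (encode s) (encode t) <= 4 * hamming s t.
Proof.
move=> st; apply: (@lipschitz_of_edges (size s) _ predT) => //.
  by move=> x y xy; rewrite !size_encode xy.
by move=> p q _ _; exact: encode_edge.
Qed.

Lemma hamming_decode n s t : ~~ odd n -> size s = n.+1 -> size t = n.+1 ->
  heavy s -> heavy t -> hamming (decode s) (decode t) <= 5 * hamming s t.
Proof.
move=> ev sn tn; apply: (@lipschitz_of_edges n.+1) => //.
- by move=> x y xy; rewrite !size_decode xy.
- exact: heavy_up.
- by move=> p q; exact: decode_edge.
Qed.

(** * Transfer to tuples *)

Lemma weightE n (x : n.-tuple bool) : weight x = count id x.
Proof.
rewrite /weight cardsE cardE -[tval x in RHS]map_tnth_enum count_map.
by rewrite -size_filter enumT.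
Qed.

Lemma distanceE n (x y : n.-tuple bool) : distance x y = hamming x y.
Proof.
rewrite /distance /hamming cardsE cardE -[tval x in RHS]map_tnth_enum.
rewrite -[tval y in RHS]map_tnth_enum zip_map count_map.
by rewrite -size_filter enumT.
Qed.

Lemma in_hamming_ball n (z : n.+1.-tuple bool) :
  (z \in hamming_ball n) = heavy z.
Proof.
rewrite inE weightE ltr_pdivrMr ?ltr0n // -natrM ltr_nat.
by rewrite /heavy size_tuple muln2.
Qed.

Local Open Scope ring_scope.

Theorem corollary1p2 (n : nat) (n_gt0 : (0 < n)%N) (n_even : ~~ odd n) :
  exists psi : n.-tuple bool -> {z : n.+1.-tuple bool | z \in hamming_ball n},
    bijective psi /\
    forall x y : n.-tuple bool, x <> y ->
      1 / 5%:R <= (distance (val (psi x)) (val (psi y)))%:R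
                    / (distance x y)%:R :> rat
      /\ (distance (val (psi x)) (val (psi y)))%:R
           / (distance x y)%:R <= 4%:R :> rat.
Proof.
have szE (x : n.-tuple bool) : size (encode x) == n.+1.
  by rewrite size_encode size_tuple.
have szD (z : n.+1.-tuple bool) : size (decode z) == n.
  by rewrite size_decode size_tuple.
have ballE (x : n.-tuple bool) : Tuple (szE x) \in hamming_ball n.
  by rewrite in_hamming_ball heavy_encode.
exists (fun x => exist _ (Tuple (szE x)) (ballE x)); split.
  exists (fun z => Tuple (szD (val z))) => [x|[z zB]]; apply: val_inj => /=.
    exact: encodeK.
  apply: val_inj; rewrite /= decodeK ?size_tuple //.
  by rewrite -in_hamming_ball.
move=> x y xy; rewrite !distanceE /=.
have upper := hamming_encode (etrans (size_tuple x) (esym (size_tuple y))).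
(* The lower bound on the ratio is the Lipschitz bound of the inverse, applied to the two images. *)
have lower : (hamming x y <= 5 * hamming (encode x) (encode y))%N.
  have := hamming_decode n_even (eqP (szE x)) (eqP (szE y)).
  by rewrite !encodeK; apply; exact: heavy_encode.
have pos : (0 < hamming x y)%N.
  rewrite lt0n -distanceE; apply/eqP => d0; apply: xy; apply: eq_from_tnth => i.
  apply/eqP/negPn/negP => ne; move/eqP: d0; rewrite cards_eq0 => /eqP/setP/(_ i).
  by rewrite !inE ne.
move: (hamming x y) (hamming _ _) upper lower pos => h h' upper lower pos.
split; last by rewrite ler_pdivrMr ?ltr0n // -natrM ler_nat.
by rewrite div1r ler_pdivlMr ?ltr0n // ler_pdivrMl ?ltr0n // -natrM ler_nat.
Qed.
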